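(* Let $d\ge 1$ and let $\{X_t,t\ge 0\}$ be a $d$-dimensional stochastic process with independent increments. Then $\{X_t,t\ge0\}$ has block-associated increments.
   Context: ''Non-decreasing'' for a function on $\mathbb{R}^m$ means non-decreasing in each coordinate. Functions applied to random vectors are understood to be Borel measurable. A process has independent increments if for every $n$ and all $0<t_1<\dots<t_n$ the random vectors $X_{t_1}-X_0, X_{t_2}-X_{t_1},\dots,X_{t_n}-X_{t_{n-1}}$ are independent. Real random variables $Y_1,\dots,Y_n$ (or the vector $(Y_1,\dots,Y_n)$) are associated if $\mathrm{Cov}(g(Y_1,\dots,Y_n),h(Y_1,\dots,Y_n))\ge 0$ for every pair of non-decreasing functions $g,h:\mathbb{R}^n\to\mathbb{R}$ for which this covariance exists. A $d$-dimensional process $\{X_t,t\ge 0\}$ has block-associated increments if for every $n\in\mathbb{N}$ and any $0<t_1<t_2<\dots<t_n$ the $nd$-dimensional vector formed by the increments $\Delta_1=X_{t_1}-X_0,\ \Delta_2=X_{t_2}-X_{t_1},\ \dots,\ \Delta_n=X_{t_n}-X_{t_{n-1}}$ is associated between blocks, the blocks being formed by the $d$ components of each increment; that is, for all non-decreasing functions $f_k:\mathbb{R}^d\to\mathbb{R}$, $k=1,\dots,n$, the random vector $(f_1(\Delta_1),\dots,f_n(\Delta_n))$ is associated. *)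

(* Defs.v *)
From HB Require Import structures.
From mathcomp Require Import all_boot all_order all_algebra.
From mathcomp Require Import all_classical all_reals all_analysis.

Set Implicit Arguments.
Unset Strict Implicit.
Unset Printing Implicit Defensive.

Import Order.TTheory GRing.Theory Num.Theory.

Local Open Scope classical_set_scope.
Local Open Scope ring_scope.

(* R^m is [m.-tuple R]; its measurable structure is the one generated by the
   coordinate projections, i.e. the Borel sigma-algebra of R^m. *)

Definition coordwise_nondecreasing (R : realType) (m : nat)
    (f : m.-tuple R -> R) : Prop :=
  forall (i : 'I_m) (x y : m.-tuple R),
    (forall j : 'I_m, j != i -> tnth x j = tnth y j) ->
    tnth x i <= tnth y i -> f x <= f y.

(* Taking some of the [A i] to be [setT] gives the product rule for every
   subfamily. *)
Definition mutually_independent (R : realType) (disp disp' : measure_display)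
    (T : measurableType disp) (T' : measurableType disp') (P : probability T R)
    (n : nat) (Y : 'I_n -> T -> T') : Prop :=
  forall A : 'I_n -> set T', (forall i, measurable (A i)) ->
    P (\bigcap_i (Y i @^-1` A i)) = (\prod_(i < n) P (Y i @^-1` A i))%E.

(* The three [Lfun P 1] (integrability) hypotheses say that
   Cov(g(Y), h(Y)) = E[g(Y)h(Y)] - E[g(Y)] E[h(Y)] exists. *)
Definition associated (R : realType) (disp : measure_display)
    (T : measurableType disp) (P : probability T R)
    (n : nat) (Y : T -> n.-tuple R) : Prop :=
  forall g h : n.-tuple R -> R,
    measurable_fun [set: n.-tuple R] g -> measurable_fun [set: n.-tuple R] h ->
    coordwise_nondecreasing g -> coordwise_nondecreasing h ->
    (g \o Y) \in Lfun P 1 -> (h \o Y) \in Lfun P 1 ->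
    ((g \o Y) * (h \o Y)) \in Lfun P 1 ->
    (0 <= covariance P (g \o Y) (h \o Y))%E.

Definition associated_between_blocks (R : realType) (disp : measure_display)
    (T : measurableType disp) (P : probability T R)
    (n d : nat) (D : 'I_n -> T -> d.-tuple R) : Prop :=
  forall f : 'I_n -> d.-tuple R -> R,
    (forall k, measurable_fun [set: d.-tuple R] (f k)) ->
    (forall k, coordwise_nondecreasing (f k)) ->
    associated P (fun w => [tuple f k (D k w) | k < n]).

(* With t = (t_1, ..., t_n) and t_0 = 0, the index k : 'I_n (which starts at 0)
   gives X_{t_{k+1}} - X_{t_k}. *)
Definition increment (R : realType) (T : Type) (d : nat)
    (X : {nonneg R} -> T -> d.-tuple R) (n : nat) (t : n.-tuple {nonneg R})
    (k : 'I_n) (w : T) : d.-tuple R :=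
  [tuple tnth (X (tnth t k) w) i
         - tnth (X (nth 0%:nng (0%:nng :: t) k) w) i | i < d].

Definition independent_increments (R : realType) (disp : measure_display)
    (T : measurableType disp) (P : probability T R)
    (d : nat) (X : {nonneg R} -> T -> d.-tuple R) : Prop :=
  forall (n : nat) (t : n.-tuple {nonneg R}), path <%R 0%:nng t ->
    mutually_independent P (increment X t).

Definition block_associated_increments (R : realType) (disp : measure_display)
    (T : measurableType disp) (P : probability T R)
    (d : nat) (X : {nonneg R} -> T -> d.-tuple R) : Prop :=
  forall (n : nat) (t : n.-tuple {nonneg R}), path <%R 0%:nng t ->
    associated_between_blocks P (increment X t).

(* Main.v *)
(* Independent real random variables Y_1, ..., Y_n are associated, and the
   f_k(Delta_k) are independent.  For bounded g and h, induct on n: writing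
   G(z) = E[g(Y_1, z)] and H(z) = E[h(Y_1, z)], Chebyshev's integral inequality
   in the first variable gives E[g(Y_1, z) h(Y_1, z)] >= G(z) H(z), and G and H
   are again bounded and non-decreasing, so Fubini and the induction hypothesis
   for (Y_2, ..., Y_n) conclude.  Truncating g and h preserves monotonicity, and
   dominated convergence removes the boundedness assumption. *)

Require Import Defs.
From mathcomp Require Import all_boot all_order all_algebra.
From mathcomp Require Import all_classical all_reals all_analysis.
From mathcomp Require Import measurable_realfun ring lra.

Import Order.TTheory GRing.Theory Num.Theory.
Import numFieldNormedType.Exports.

Local Open Scope classical_set_scope.
Local Open Scope ring_scope.

(** * Integrals of bounded functions and Chebyshev's integral inequality *)

Section bounded_functions.
Context {R : realType} {disp : measure_display} {T : measurableType disp}.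
Implicit Type P : probability T R.

Lemma bounded_fun_integrable P (f : T -> R) (M : R) :
  measurable_fun setT f -> (forall x, `|f x| <= M) ->
  P.-integrable setT (EFin \o f).
Proof.
move=> mf fM; apply: measurable_bounded_integrable => //.
  by rewrite ltey_eq fin_num_measure.
exists M; split; [exact: num_real|move=> x /ltW Mx y _].
exact: le_trans Mx.
Qed.

(** The total mass is 1, so the constant [M] integrates to [M]. *)
Lemma le_normr_Rintegral_bounded P (f : T -> R) (M : R) :
  measurable_fun setT f -> (forall x, `|f x| <= M) ->
  `|\int[P]_x f x| <= M.
Proof.
move=> mf fM.
have iM : P.-integrable setT (EFin \o cst M).
  by apply: (@bounded_fun_integrable _ _ `|M|).
apply: le_trans (le_normr_Rintegral measurableT _) _.
  exact: bounded_fun_integrable fM.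
have <- : \int[P]_(x in setT) M = M.
  by rewrite Rintegral_cst//= probability_setT mulr1.
apply: le_Rintegral => //.
apply: (@bounded_fun_integrable _ _ M); first exact: measurableT_comp.
by move=> x; rewrite normr_id.
Qed.

(* Expand the double integral of (g x - g y)(h x - h y). *)
Lemma Chebyshev_integral_inequality P (g h : T -> R) (M : R) :
  measurable_fun setT g -> measurable_fun setT h ->
  (forall x, `|g x| <= M) -> (forall x, `|h x| <= M) ->
  (forall x y, 0 <= (g x - g y) * (h x - h y)) ->
  (\int[P]_x g x) * (\int[P]_x h x) <= \int[P]_x (g x * h x).
Proof.
move=> mg mh gM hM gh.
have ig := bounded_fun_integrable P _ _ mg gM.
have ih := bounded_fun_integrable P _ _ mh hM.
have igh : P.-integrable setT (EFin \o (fun x => g x * h x)).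
  apply: (@bounded_fun_integrable _ _ (M * M)).
    exact: measurable_funM.
  by move=> x; rewrite normrM ler_pM.
have ic c : P.-integrable setT (EFin \o cst c).
  by apply: (@bounded_fun_integrable _ _ `|c|).
have iZ c (f : T -> R) : P.-integrable setT (EFin \o f) ->
    P.-integrable setT (EFin \o (fun x => c * f x)).
  by move=> /(integrableZl measurableT c).
have iD (f k : T -> R) : P.-integrable setT (EFin \o f) ->
    P.-integrable setT (EFin \o k) ->
    P.-integrable setT (EFin \o (fun x => f x + k x)).
  by move=> i1 i2; exact: (integrableD measurableT i1 i2).
have cE c : \int[P]_(x in setT) c = c.
  by rewrite Rintegral_cst//= probability_setT mulr1.
set a := \int[P]_x g x; set b := \int[P]_x h x; set c := \int[P]_x _.
(* First integration, in [x] with [y] frozen: the product of differences expands into four terms,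
   each integrated by linearity. *)
have inner y : 0 <= c + (- g y * b + (- h y * a + g y * h y)).
  have -> : c + (- g y * b + (- h y * a + g y * h y)) =
      \int[P]_x ((g x - g y) * (h x - h y)).
    under [RHS]eq_Rintegral => x _.
      rewrite (_ : _ * _ = g x * h x +
        (- g y * h x + (- h y * g x + g y * h y))); last by ring.
      over.
    rewrite RintegralD//; last first.
      by apply: (iD); [exact: iZ|apply: (iD); [exact: iZ|exact: ic]].
    rewrite RintegralD//; [|exact: iZ|by apply: (iD); [exact: iZ|exact: ic]].
    rewrite RintegralD//; [|exact: iZ|exact: ic].
    by rewrite cE !RintegralZl.
  exact: Rintegral_ge0.
(* Second integration, in [y]: the four terms become c - ba - ab + c, so 2(c - ab) is
   nonnegative. *)
have : 0 <= \int[P]_y (c + (- b * g y + (- a * h y + g y * h y))).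
  apply: Rintegral_ge0 => y _; have := inner y.
  by rewrite !mulNr [b * _]mulrC [a * _]mulrC.
rewrite RintegralD//; [|exact: ic|].
  2: by apply: (iD); [exact: iZ|apply: (iD) => //; exact: iZ].
rewrite RintegralD//; [|exact: iZ|by apply: (iD) => //; exact: iZ].
rewrite RintegralD//; [|exact: iZ].
rewrite cE !RintegralZl// -/a -/b -/c; lra.
Qed.

End bounded_functions.

(** * Fubini's theorem for a pair of independent random elements *)

Section independent_pair.
Context {R : realType} {disp d1 d2 : measure_display} {T : measurableType disp}
  {S1 : measurableType d1} {S2 : measurableType d2}.
Variables (P : probability T R) (U : {mfun T >-> S1}) (V : {mfun T >-> S2}).
Variables (F : S1 * S2 -> R) (M : R).
Hypotheses (mF : measurable_fun setT F) (FM : forall x, `|F x| <= M).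

(** This is the Fubini marginal in [y] of [F (U v, y)], a bounded and hence integrable function for
    the product of [P] and the law of [V]. *)
Lemma measurable_Rintegral_param :
  measurable_fun setT (fun y => \int[P]_v F (U v, y)).
Proof.
pose f (z : T * S2) := (F (U z.1, z.2))%:E.
have mf : measurable_fun setT (fun z : T * S2 => F (U z.1, z.2)).
  apply: measurableT_comp => //; apply: measurable_fun_pair => //.
  exact: measurableT_comp.
have /measurable_fubini_G : (P \x distribution P V)%E.-integrable setT f.
  exact: (bounded_fun_integrable (P \x distribution P V)%E _ M).
by move=> mG; exact: measurableT_comp mG.
Qed.

Hypothesis UV : forall A B, measurable A -> measurable B ->
  P (U @^-1` A `&` V @^-1` B) = (P (U @^-1` A) * P (V @^-1` B))%E.

(** Independence turns the joint law of [(U, V)] into the product of the two laws. Fubini then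
    integrates the [U] variable first, and changes of variables bring both integrals back to [P]. *)
Lemma Rintegral_independent :
  \int[P]_w F (U w, V w) = \int[P]_w \int[P]_v F (U v, V w).
Proof.
have mUV : measurable_fun setT (fun w => (U w, V w)).
  exact: measurable_fun_pair.
have iF : (distribution P U \x distribution P V)%E.-integrable setT (EFin \o F).
  exact: (bounded_fun_integrable (distribution P U \x distribution P V)%E _ M).
pose UVm : {mfun T >-> (S1 * S2)%type} := mfun_Sub (mem_set mUV).
have inner y : (\int[distribution P U]_x (F (x, y))%:E =
                (\int[P]_v F (U v, y))%:E)%E.
  have iFy : P.-integrable setT (EFin \o (fun v => F (U v, y))).
    apply: (bounded_fun_integrable _ _ M) => //.
    by apply: measurableT_comp => //; exact: measurable_fun_pair.
  rewrite fineK ?integrable_fin_num//.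
  rewrite (integral_distribution (f := fun x => (F (x, y))%:E))//.
  by apply/measurable_EFinP; exact: measurableT_comp.
rewrite {1 2}/Rintegral; congr fine.
transitivity (\int[distribution P UVm]_z (F z)%:E)%E.
  rewrite integral_distribution//; first exact/measurable_EFinP.
  apply: (bounded_fun_integrable _ _ M) => //.
  exact: measurableT_comp.
(* The joint law and the product law agree on rectangles by [UV], hence on all measurable sets. *)
transitivity (\int[distribution P U \x distribution P V]_z (F z)%:E)%E.
  apply: eq_measure_integral => A mA _; apply/esym.
  exact: product_measure_unique.
rewrite -integral21_prod_meas1// /fubini_G.
transitivity (\int[distribution P V]_y (\int[P]_v F (U v, y))%:E)%E.
  by apply: eq_integral => y _; exact: inner.
rewrite integral_distribution//.
  by apply/measurable_EFinP; exact: measurable_Rintegral_param.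
apply: (bounded_fun_integrable _ _ M) => [|w].
  by apply: (measurableT_comp measurable_Rintegral_param).
apply: le_normr_Rintegral_bounded => //.
by apply: measurableT_comp => //; exact: measurable_fun_pair.
Qed.

End independent_pair.

(** * Independence of the first coordinate from the remaining ones *)

Section mutual_independence.
Context {R : realType} {disp dS : measure_display} {T : measurableType disp}
  {S : measurableType dS} (P : probability T R).

(** Taking [setT] at index [ord0] contributes a factor 1 to the product. *)
Lemma mutually_independent_lift0 n (Y : 'I_n.+1 -> T -> S) :
  mutually_independent P Y ->
  mutually_independent P (fun i => Y (lift ord0 i)).
Proof.
move=> indY A mA.
pose A' (i : 'I_n.+1) := oapp A setT (unlift ord0 i).
have mA' i : measurable (A' i).
  by rewrite /A'; case: unliftP => [j _|_] /=; [exact: mA|exact: measurableT].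
have := indY _ mA'; rewrite big_ord_recl /A' unlift_none /= preimage_setT.
rewrite probability_setT mul1e.
under eq_bigr do rewrite liftK /=.
move=> <-; congr (P _); apply/seteqP; split => w Yw i _ /=.
- by case: unliftP => [j ->|//] /=; exact: Yw.
- by have := Yw (lift ord0 i) I; rewrite /= liftK.
Qed.

Lemma measurable_tuple_of n (Y : 'I_n -> T -> S) :
  (forall i, measurable_fun setT (Y i)) ->
  measurable_fun setT (fun w => [tuple Y i w | i < n]).
Proof.
move=> mY; apply/measurable_fun_tnthP => i.
by rewrite (_ : _ \o _ = Y i)//; apply/funext => w /=; rewrite tnth_mktuple.
Qed.

(** Unlike the cylinders that define the tuple sigma-algebra, boxes are stable under intersection,
    as uniqueness of measures requires. A cylinder is a box with all other sides [setT]; a box is a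
    finite intersection of cylinders. *)
Lemma tuple_measurable_boxes n :
  @measurable _ (n.-tuple S) =
  <<s [set B | exists2 A : 'I_n -> set S, (forall i, measurable (A i)) &
         B = \bigcap_i ((@tnth n S)^~ i @^-1` A i)] >>.
Proof.
apply/seteqP; split.
- apply: smallest_sub; first exact: smallest_sigma_algebra.
  elim/big_ind : _ => // [B C ? ?|i _]; first by rewrite subUset.
  move=> _ [A mA <-]; apply: sub_sigma_algebra.
  exists (fun j => if j == i then A else setT) => [j|]; first by case: ifP.
  rewrite setTI; apply/seteqP; split => x /=.
    by move=> Ax j _ /=; case: ifP => // /eqP ->.
  by move=> /(_ i I) /=; rewrite eqxx.
- apply: smallest_sub; first exact: sigma_algebra_measurable.
  move=> _ [A mA ->]; apply: fin_bigcap_measurable => // i _.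
  by rewrite -[X in measurable X]setTI; exact: measurable_tnth.
Qed.

(** For fixed [A], both sides are finite measures in [B]. They agree on boxes by mutual
    independence, hence on the sigma-algebra that boxes generate. *)
Lemma mutually_independent_head_tail n (Y : 'I_n.+1 -> T -> S) :
  (forall i, measurable_fun setT (Y i)) -> mutually_independent P Y ->
  forall A B, measurable A -> measurable B ->
  let Z w := [tuple Y (lift ord0 i) w | i < n] in
  P (Y ord0 @^-1` A `&` Z @^-1` B) = (P (Y ord0 @^-1` A) * P (Z @^-1` B))%E.
Proof.
move=> mY indY A B mA mB Z.
have mZ : measurable_fun setT Z by exact: measurable_tuple_of.
have mYA : measurable (Y ord0 @^-1` A).
  by rewrite -[X in measurable X]setTI; exact: mY.
have PA0 : 0 <= fine (P (Y ord0 @^-1` A)) by exact: fine_ge0.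
pose Zm : {mfun T >-> n.-tuple S} := mfun_Sub (mem_set mZ).
(* [m1] is the image under [Z] of [P] restricted to the event on [Y ord0]; [m2] below is the law of
   [Z] scaled by the probability of that event. *)
have [m1 m1E] : exists m : {measure set (n.-tuple S) -> \bar R},
    forall C, m C = P (Y ord0 @^-1` A `&` Z @^-1` C).
  unshelve eexists; first by apply: (pushforward (mrestr P mYA) Z).
  by move=> C; rewrite setIC.
have [m2 m2E] : exists m : {measure set (n.-tuple S) -> \bar R},
    forall C, m C = (P (Y ord0 @^-1` A) * P (Z @^-1` C))%E.
  exists (mscale (NngNum PA0) (distribution P Zm)) => C.
  by rewrite -[X in (X * _)%E]fineK// fin_num_measure.
rewrite -m1E -m2E.
pose G := [set B | exists2 A : 'I_n -> set S, (forall i, measurable (A i)) &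
         B = \bigcap_i ((@tnth n S)^~ i @^-1` A i)].
have GT : G setT.
  exists (fun=> setT) => [i|]; first exact: measurableT.
  by apply/seteqP; split.
apply: (measure_unique G (fun=> setT)) => //.
- exact: tuple_measurable_boxes.
- move=> _ _ [A1 mA1 ->] [A2 mA2 ->].
  exists (fun i => A1 i `&` A2 i); first by move=> i; exact: measurableI.
  by rewrite -bigcapI; apply: eq_bigcapr.
- by rewrite bigcup_const.
- move=> C [D mD ->].
  (* [D'] puts [A] at [ord0] and the sides of the box elsewhere. Independence of the tail then folds
     the last [n] factors into one probability. *)
  pose D' (i : 'I_n.+1) := oapp D A (unlift ord0 i).
  have mD' i : measurable (D' i) by rewrite /D'; case: unliftP => [j _|_] /=.
  have := indY _ mD'; rewrite big_ord_recl /D' unlift_none /=.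
  under eq_bigr do rewrite liftK /=.
  rewrite -(mutually_independent_lift0 _ _ indY)// => PYD.
  rewrite m1E m2E; have ZE : Z @^-1` (\bigcap_i ((@tnth n S)^~ i @^-1` D i)) =
      \bigcap_i (Y (lift ord0 i) @^-1` D i).
    by apply/seteqP; split => w + i _ => /(_ i I); rewrite /= tnth_mktuple.
  rewrite ZE -PYD; congr (P _); apply/seteqP; split => w.
    by move=> [YA YD] i _ /=; case: unliftP => [j ->|->] /=; [exact: YD|].
  move=> YD; split; first by have := YD ord0 I; rewrite /= unlift_none.
  by move=> i _; have := YD (lift ord0 i) I; rewrite /= liftK.
- by move=> _; rewrite m1E ltey_eq fin_num_measure// preimage_setT setIT.
Qed.

End mutual_independence.

(** * Association of independent real variables: the bounded case *)

Section association.
Context {R : realType} {disp : measure_display} {T : measurableType disp}.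
Variable P : probability T R.

Lemma coordwise_nondecreasing_cons_head n (g : n.+1.-tuple R -> R)
    (z : n.-tuple R) (x y : R) :
  coordwise_nondecreasing g -> x <= y ->
  g [tuple of x :: z] <= g [tuple of y :: z].
Proof.
move=> ndg xy; apply: (ndg ord0) => [j j0|]; last by rewrite !tnth0.
by case: (unliftP ord0 j) j0 => [k ->|->]; rewrite ?eqxx// !tnthS.
Qed.

Lemma coordwise_nondecreasing_cons_tail n (g : n.+1.-tuple R -> R) (x : R) :
  coordwise_nondecreasing g ->
  coordwise_nondecreasing (fun z : n.-tuple R => g [tuple of x :: z]).
Proof.
move=> ndg i z1 z2 z12 le12; apply: (ndg (lift ord0 i)) => [j|]; last first.
  by rewrite !tnthS.
case: (unliftP ord0 j) => [k ->|-> _]; last by rewrite !tnth0.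
by rewrite (inj_eq lift_inj) !tnthS => /z12.
Qed.

Lemma mutually_independent_le_Rintegral_mul n (Y : 'I_n -> T -> R)
    (g h : n.-tuple R -> R) (M : R) :
  (forall i, measurable_fun setT (Y i)) -> mutually_independent P Y ->
  measurable_fun setT g -> measurable_fun setT h ->
  (forall x, `|g x| <= M) -> (forall x, `|h x| <= M) ->
  coordwise_nondecreasing g -> coordwise_nondecreasing h ->
  (\int[P]_w g [tuple Y i w | i < n]) * (\int[P]_w h [tuple Y i w | i < n]) <=
  \int[P]_w (g [tuple Y i w | i < n] * h [tuple Y i w | i < n]).
Proof.
elim: n Y g h => [|n IH] Y g h mY indY mg mh gM hM ndg ndh;
  pose Z w := [tuple Y i w | i < _];
  change ((\int[P]_w g (Z w)) * (\int[P]_w h (Z w)) <=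
          \int[P]_w (g (Z w) * h (Z w))).
  have mZ : measurable_fun setT Z by exact: measurable_tuple_of.
  (* With no coordinates [Z] is constant, so the differences in Chebyshev's inequality vanish. *)
  apply: (Chebyshev_integral_inequality P _ _ M) => //.
  - exact: measurableT_comp.
  - exact: measurableT_comp.
  - by move=> x y; rewrite (tuple0 (Z x)) (tuple0 (Z y)) subrr mul0r.
pose Y' i := Y (lift ord0 i); pose Z' w := [tuple Y' i w | i < n].
have mY' i : measurable_fun setT (Y' i) by exact: mY.
have mZ' : measurable_fun setT Z' by exact: measurable_tuple_of.
have ZE w : Z w = [tuple of Y ord0 w :: Z' w].
  apply: eq_from_tnth => i; rewrite tnth_mktuple.
  by case: (unliftP ord0 i) => [j ->|->]; rewrite ?tnth0// tnthS tnth_mktuple.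
pose U : {mfun T >-> R} := mfun_Sub (mem_set (mY ord0)).
pose V : {mfun T >-> n.-tuple R} := mfun_Sub (mem_set mZ').
have UV A B : measurable A -> measurable B ->
    P (U @^-1` A `&` V @^-1` B) = (P (U @^-1` A) * P (V @^-1` B))%E.
  exact: mutually_independent_head_tail.
pose cons_pair (p : R * n.-tuple R) := [tuple of p.1 :: p.2].
have mcons : measurable_fun setT cons_pair by exact: measurable_cons.
(* [E] averages out the first coordinate. *)
pose E f z := \int[P]_v f (cons_pair (Y ord0 v, z)).
have mEf (f : n.+1.-tuple R -> R) :
    measurable_fun setT f -> (forall x, `|f x| <= M) ->
    measurable_fun setT (E f).
  move=> mf fM.
  apply: (measurable_Rintegral_param P U V (f \o cons_pair) M) => [|p].
    exact: measurableT_comp.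
  exact: fM.
have mfc (f : n.+1.-tuple R -> R) (z : n.-tuple R) : measurable_fun setT f ->
    measurable_fun setT (fun v => f (cons_pair (Y ord0 v, z))).
  move=> mf; apply: measurableT_comp => //; apply: measurableT_comp => //.
  exact: measurable_fun_pair.
have Ef_bound (f : n.+1.-tuple R -> R) (z : n.-tuple R) :
    measurable_fun setT f -> (forall x, `|f x| <= M) ->
    `|E f z| <= M.
  by move=> mf fM; apply: le_normr_Rintegral_bounded => //; exact: mfc.
have Ef_nd (f : n.+1.-tuple R -> R) :
    measurable_fun setT f -> (forall x, `|f x| <= M) ->
    coordwise_nondecreasing f -> coordwise_nondecreasing (E f).
  move=> mf fM ndf i z1 z2 z12 le12; apply: le_Rintegral => //.
  - by apply: (bounded_fun_integrable _ _ M) => //; exact: mfc.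
  - by apply: (bounded_fun_integrable _ _ M) => //; exact: mfc.
  - by move=> v _; exact: coordwise_nondecreasing_cons_tail le12.
(* The bound [N] is left free: it will be [M] for [g] and [h], and [M * M] for their product. *)
have split_int (f : n.+1.-tuple R -> R) (N : R) :
    measurable_fun setT f -> (forall x, `|f x| <= N) ->
    \int[P]_w f (Z w) = \int[P]_w E f (Z' w).
  move=> mf fN.
  transitivity (\int[P]_w (f \o cons_pair) (U w, V w)).
    by apply: eq_Rintegral => w _; rewrite ZE.
  apply: (Rintegral_independent P U V (f \o cons_pair) N) => //.
    exact: measurableT_comp.
  by move=> p; exact: fN.
have mgh : measurable_fun setT (g \* h) by exact: measurable_funM.
have ghM x : `|(g \* h) x| <= M * M by rewrite /= normrM ler_pM.
rewrite (split_int _ _ mg gM) (split_int _ _ mh hM).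
rewrite (split_int (g \* h) (M * M))//.
(* The induction hypothesis leads to the integral of [E g * E h] along [Z']; it remains to compare
   this product pointwise with [E (g \* h)]. *)
apply: le_trans (IH Y' (E g) (E h) _ _ _ _ _ _ _ _) _ => //.
- exact: mutually_independent_lift0.
- exact: mEf.
- exact: mEf.
- by move=> z; exact: Ef_bound.
- by move=> z; exact: Ef_bound.
- exact: Ef_nd.
- exact: Ef_nd.
apply: le_Rintegral => //.
- apply: (bounded_fun_integrable _ _ (M * M)) => [|w].
    by apply: measurable_funM; apply: measurableT_comp => //; exact: mEf.
  by rewrite normrM ler_pM//; exact: Ef_bound.
- apply: (bounded_fun_integrable _ _ (M * M)) => [|w].
    apply: (measurableT_comp (measurable_Rintegral_param P U V
      ((g \* h) \o cons_pair) (M * M) _ _)) => //.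
      exact: measurableT_comp.
    by move=> p; exact: ghM.
  by apply: le_normr_Rintegral_bounded => //; exact: (mfc (g \* h)).
- move=> w _; apply: (Chebyshev_integral_inequality P _ _ M) => //.
  + exact: mfc.
  + exact: mfc.
  (* Swapping [x] and [y] flips the sign of both factors, so one may take [Y ord0 x <= Y ord0 y];
     then both factors are nonpositive. *)
  + move=> x y; wlog : x y / Y ord0 x <= Y ord0 y => [hwlog|xy].
      case/orP: (le_total (Y ord0 x) (Y ord0 y)) => [|yx]; first exact: hwlog.
      by rewrite -mulrNN !opprB; exact: hwlog.
    by apply: mulr_le0; rewrite subr_le0;
    exact: coordwise_nondecreasing_cons_head.
Qed.

(** * Truncation and passage to unbounded functions *)

Definition truncation (n : nat) (x : R) : R :=
  Num.max (- n%:R) (Num.min x n%:R).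

Lemma truncation_homo n : {homo truncation n : x y / x <= y}.
Proof.
move=> x y xy; rewrite /truncation ge_max le_max lexx/= le_max.
by rewrite le_min !ge_min lexx xy !orbT.
Qed.

Lemma measurable_truncation n : measurable_fun setT (truncation n).
Proof. by apply: measurable_maxr => //; exact: measurable_minr. Qed.

Lemma truncation_bounded n x : `|truncation n x| <= n%:R.
Proof.
rewrite ler_norml /truncation le_max lexx/= ge_max ge_min lexx orbT andbT.
by rewrite (le_trans _ (ler0n _ n))// oppr_le0.
Qed.

Lemma truncation_le_normr n x : `|truncation n x| <= `|x|.
Proof.
rewrite /truncation; have n0 : 0 <= n%:R :> R by [].
have [xn|nx] := leP x n%:R; last first.
  rewrite max_r; last by lra.
  by rewrite ger0_norm// ger0_norm; lra.
have [nx|xn'] := leP (- n%:R) x => //.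
by rewrite normrN ger0_norm// ler0_norm; lra.
Qed.

Lemma truncation_near x : \forall n \near \oo, truncation n x = x.
Proof.
near=> n; have /ler_normlP[xn1 xn2] : `|x| <= n%:R.
  by near: n; exact: nbhs_infty_ger.
by rewrite /truncation min_l// max_r//; lra.
Unshelve. all: by end_near. Qed.

(** Dominated convergence, with the absolute value of the limit as dominating function. Eventual
    equality holds for truncations and passes at once to their products. *)
Lemma cvg_Rintegral_eventually (f_ : nat -> T -> R) (f : T -> R) :
  (forall n, measurable_fun setT (f_ n)) ->
  P.-integrable setT (EFin \o f) ->
  (forall n x, `|f_ n x| <= `|f x|) ->
  (forall x, \forall n \near \oo, f_ n x = f x) ->
  (\int[P]_x f_ n x) @[n --> \oo] --> \int[P]_x f x.
Proof.
move=> mf_ intf f_f cvf.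
have [] := @dominated_convergence _ _ _ P setT measurableT
  (fun n => EFin \o f_ n) (EFin \o f) (abse \o (EFin \o f)).
- by move=> n; exact/measurable_EFinP.
- exact: measurable_int intf.
- apply: aeW => x _; apply: cvg_near_cst.
  by apply: filterS (cvf x) => n /= ->.
- exact: integrable_abse.
- by apply: aeW => x n _; rewrite /= lee_fin.
move=> _ _; rewrite -(fineK (integrable_fin_num measurableT intf)).
exact: fine_cvg.
Qed.

Lemma mutually_independent_associated n (Y : 'I_n -> T -> R) :
  (forall i, measurable_fun setT (Y i)) -> mutually_independent P Y ->
  associated P (fun w => [tuple Y i w | i < n]).
Proof.
move=> mY indY g h mg mh ndg ndh; set Z := fun w => _.
have mZ : measurable_fun setT Z by exact: measurable_tuple_of.
move=> Lg Lh Lgh; rewrite covarianceE// unlock.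
move: Lg Lh Lgh => /Lfun1_integrable ig /Lfun1_integrable ih.
move=> /Lfun1_integrable igh.
(* Integrability makes the three expectations finite, which reduces the claim to an inequality
   between real integrals. *)
rewrite -[X in (_ <= X - _)%E]fineK ?integrable_fin_num//.
rewrite -[X in (_ <= _ - X * _)%E]fineK ?integrable_fin_num//.
rewrite -[X in (_ <= _ - _ * X)%E]fineK ?integrable_fin_num//.
rewrite -EFinM -EFinB lee_fin subr_ge0.
pose tr k (f : n.-tuple R -> R) w := truncation k (f (Z w)).
have mtr k (f : n.-tuple R -> R) :
    measurable_fun setT f -> measurable_fun setT (tr k f).
  move=> mf; apply: (measurableT_comp (measurable_truncation k)).
  exact: measurableT_comp.
have cvtr (f : n.-tuple R -> R) :
    measurable_fun setT f -> P.-integrable setT (EFin \o (f \o Z)) ->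
    (\int[P]_w tr k f w) @[k --> \oo] --> \int[P]_w f (Z w).
  move=> mf intf; apply: cvg_Rintegral_eventually => //.
  - by move=> k; exact: mtr.
  - by move=> k w; exact: truncation_le_normr.
  - by move=> w; exact: truncation_near.
(* Truncation shrinks each factor in absolute value, so the product of truncations is dominated by
   the product itself, integrable by [igh]. *)
have cvtrM : (\int[P]_w (tr k g w * tr k h w)) @[k --> \oo] -->
    \int[P]_w (g (Z w) * h (Z w)).
  apply: cvg_Rintegral_eventually => //.
  - by move=> k; apply: measurable_funM; exact: mtr.
  - by move=> k w; rewrite !normrM ler_pM//; exact: truncation_le_normr.
  - move=> w; near=> k; rewrite /tr.
    by congr (_ * _); near: k; exact: truncation_near.
(* The inequality passes to the limit; for each [k] it is the bounded case with bound [k]. *)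
apply: (ler_cvg_to (cvgM (cvtr g mg ig) (cvtr h mh ih)) cvtrM).
apply: nearW => k.
have tr_nd (f : n.-tuple R -> R) : coordwise_nondecreasing f ->
    coordwise_nondecreasing (truncation k \o f).
  by move=> ndf i x y xy le; apply: truncation_homo; exact: ndf le.
apply: (mutually_independent_le_Rintegral_mul _ Y (truncation k \o g)
  (truncation k \o h) k%:R) => //.
- by apply: measurableT_comp => //; exact: measurable_truncation.
- by apply: measurableT_comp => //; exact: measurable_truncation.
- by move=> x; exact: truncation_bounded.
- by move=> x; exact: truncation_bounded.
- exact: tr_nd.
- exact: tr_nd.
Unshelve. all: by end_near. Qed.

End association.

(** * From independent increments to block association *)

(** Preimages of measurable sets under [f k] are measurable, so the product rule for the
    compositions is an instance of the one for [D]. *)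
Lemma mutually_independent_comp {R : realType} {disp d1 d2 : measure_display}
    {T : measurableType disp} {S1 : measurableType d1} {S2 : measurableType d2}
    (P : probability T R) (n : nat) (D : 'I_n -> T -> S1)
    (f : 'I_n -> S1 -> S2) :
  (forall k, measurable_fun setT (f k)) ->
  mutually_independent P D -> mutually_independent P (fun k => f k \o D k).
Proof.
move=> mf indD A mA; apply: (indD (fun k => f k @^-1` A k)) => k.
by rewrite -[X in measurable X]setTI; exact: mf.
Qed.

Lemma measurable_increment {R : realType} {disp : measure_display}
    {T : measurableType disp} (d : nat) (X : {nonneg R} -> T -> d.-tuple R)
    (n : nat) (t : n.-tuple {nonneg R}) (k : 'I_n) :
  (forall s, measurable_fun setT (X s)) ->
  measurable_fun setT (increment X t k).
Proof.
move=> mX; apply: measurable_tuple_of => i.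
by apply: measurable_funB; exact: (measurableT_comp (measurable_tnth i) (mX _)).
Qed.

Theorem theorem3p2 (R : realType) (disp : measure_display)
    (T : measurableType disp) (P : probability T R)
    (d : nat) (hd : (1 <= d)%N)
    (X : {nonneg R} -> {RV P >-> d.-tuple R}) :
  independent_increments P (fun t => X t : T -> d.-tuple R) ->
  block_associated_increments P (fun t => X t : T -> d.-tuple R).
Proof.
move=> indX n t t_sorted f mf _.
apply: mutually_independent_associated => [k|].
  apply: (measurableT_comp (mf k)).
  apply: (measurable_increment d (fun s => X s : T -> d.-tuple R)) => s.
  exact: measurable_funPT.
by apply: mutually_independent_comp => //; exact: indX.
Qed.
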